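(* Let $H$ be a collection of probability measures on a measurable space $\mathcal{X}$, let $Q$ be a probability measure on $\mathcal{X}$ with generalized Lebesgue decomposition $Q=Q_a+Q_s$ with respect to $H$, and let $U:[0,\infty]\to[-\infty,\infty]$ be measurable. Suppose that $\lambda^*\in[0,\infty)$, $P^*\in H^{\mathrm{eff}}$ with $P^*\ll Q_a$, and $\varepsilon^*\in\mathcal{E}(H)$ satisfy $$\varepsilon^*(x)\in\operatorname*{arg\,max}_{z\in[0,\infty)}\left\{U(z)-\lambda^*\frac{dP^*}{dQ_a}(x)\,z\right\},\quad Q_a\text{-a.s.},\qquad(\star)$$ with $\lambda^*(1-\mathrm{E}^{P^*}[\varepsilon^*])=0$ and $U(\varepsilon^* )$ $Q_a$-almost surely finite. - Positive multiplier. If $U$ is strictly increasing and $Q_a(\mathcal{X})>0$, then $\lambda^*>0$ and $\mathrm{E}^{P^*}[\varepsilon^*]=1$. - Supergradient form. If $U$ is concave, then $(\star)$ is equivalent to $$\lambda^*\frac{dP^*}{dQ_a}\in\partial U(\varepsilon^* ),\quad Q_a\text{-a.s.}$$ - Positivity. If $U(0)\in\mathbb{R}$ and $\lim_{z\downarrow 0}(U(z)-U(0))/z=\infty$, then $\varepsilon^*>0$, $Q_a$-almost surely. - Explicit form. Suppose that $U(0)=\lim_{z\downarrow 0}U(z)$ and that $U$ is differentiable on $(0,\infty)$ with strictly decreasing derivative satisfying $\lim_{z\downarrow 0}U'(z)=\infty$ and $\lim_{z\to\infty}U'(z)=0$. If $Q_a(\mathcal{X})>0$, then $\lambda^*>0$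 and $$\varepsilon^*=(U')^{-1}\left(\lambda^*\frac{dP^*}{dQ_a}\right),\quad Q_a\text{-a.s.}$$
   Context: Notation: $\mathrm{E}^\mu[f]=\int f\,d\mu$ for any nonnegative measure $\mu$; Radon--Nikodym derivatives are taken $[0,\infty)$-valued. Concavity and strict monotonicity of $U$ are understood on $[0,\infty)$ (valid e-values are finite $Q_a$-a.s., so $U(\infty)$ is immaterial). $\partial U$ denotes the superdifferential: for $x\in[0,\infty)$ with $U(x)$ finite, $\partial U(x)=\{g\in\mathbb{R}: U(z)-U(x)\le g(z-x)\ \text{for all } z\in[0,\infty)\}$. An event is $H$-negligible if it has probability zero under every $P\in H$. The generalized Lebesgue decomposition of $Q$ with respect to $H$ is $Q=Q_a+Q_s$, where the nonnegative measure $Q_s$ is concentrated on an $H$-negligible event and the nonnegative measure $Q_a$ assigns zero mass to every $H$-negligible event. The class of valid e-values for $H$ is $\mathcal{E}(H)=\{\varepsilon:\mathcal{X}\to[0,\infty]\ \text{measurable}: \mathrm{E}^P[\varepsilon]\le 1\ \text{for all } P\in H\}$. With $M_+$ the collection of nonnegative measures on $\mathcal{X}$, the effective hypothesis is $H^{\mathrm{eff}}=\{P\in M_+: \mathrm{E}^P[\varepsilon]\le 1\ \text{for all } \varepsilon\in\mathcal{E}(H)\}$. *)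

(* Defs.v *)
From HB Require Import structures.
From mathcomp Require Import all_boot all_order all_algebra.
From mathcomp Require Import all_classical all_reals all_analysis.
From mathcomp Require Import measurable_realfun.

Set Implicit Arguments.
Unset Strict Implicit.
Unset Printing Implicit Defensive.

Import Order.TTheory GRing.Theory Num.Theory.
Import numFieldNormedType.Exports.

Local Open Scope classical_set_scope.
Local Open Scope ring_scope.
Local Open Scope ereal_scope.

Section Hypotheses.
Context {d : measure_display} {X : measurableType d} {R : realType}.
Implicit Type H : set (probability X R).

Definition negligible_event H (N : set X) : Prop :=
  measurable N /\ forall P, H P -> P N = 0.

Definition lebesgue_decomposition H (Q Qa Qs : {measure set X -> \bar R})
    : Prop :=
  [/\ forall A, measurable A -> Q A = Qa A + Qs A,
      exists2 N, negligible_event H N & Qs (~` N) = 0 &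
      forall N, negligible_event H N -> Qa N = 0].

Definition e_value H : set (X -> \bar R) :=
  [set eps : X -> \bar R | [/\ measurable_fun [set: X] eps,
                 forall x, 0 <= eps x &
                 forall P, H P -> \int[P]_x eps x <= 1]].

Definition effective_hypothesis H : set {measure set X -> \bar R} :=
  [set P : {measure set X -> \bar R} | forall eps, e_value H eps -> \int[P]_x eps x <= 1].

(* A [0, oo)-valued version of dP/dQ. The library's ['d nu '/d mu] is an
   arbitrary version, of a finite charge, and may be negative on a null set. *)
Definition RN_derivative (P Q : {measure set X -> \bar R}) (rho : X -> R)
    : Prop :=
  [/\ measurable_fun [set: X] rho,
      forall x, (0 <= rho x)%R &
      forall A, measurable A -> P A = \int[Q]_(x in A) (rho x)%:E].

End Hypotheses.

Definition argmax {R : realType} {T : Type} (D : set T) (f : T -> \bar R)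
    : set T :=
  [set z | D z /\ forall w, D w -> f w <= f z].

(* A utility [0, oo] -> [-oo, oo] is a total function on [\bar R] whose values
   at negative arguments are never used. *)
Section Utility.
Context {R : realType}.
Implicit Type U : \bar R -> \bar R.

(* [0, oo); the interval [`[0, +oo[] of [\bar R] would contain +oo. *)
Definition nonneg_reals : set (\bar R) := [set z | 0 <= z < +oo].

Definition strictly_increasing U : Prop :=
  forall x y, nonneg_reals x -> nonneg_reals y -> x < y -> U x < U y.

(* As +oo + -oo = -oo in [\bar R], the inequality is vacuous when U takes
   opposite infinite values at x and y: this is convexity of the hypograph. *)
Definition concave U : Prop :=
  forall (x y : \bar R) (t : R), nonneg_reals x -> nonneg_reals y ->
    (0 < t < 1)%R ->
    t%:E * U x + (1 - t)%:E * U y <= U (t%:E * x + (1 - t)%:E * y).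

Definition superdifferential U (x : \bar R) : set R :=
  [set g | [/\ nonneg_reals x, U x \is a fin_num &
               forall z, nonneg_reals z -> U z - U x <= g%:E * (z - x)]].

Definition real_part U : R -> R := fun z => fine (U z%:E).

Definition U' U : R -> R := (real_part U)^`()%classic.

Definition differentiable_on_pos U : Prop :=
  forall z : R, (0 < z)%R ->
    U z%:E \is a fin_num /\ derivable (real_part U) z 1%R.

(* Inverse of the restriction of U' to (0, oo); junk value 0 off its image. *)
Definition U'_inv U : R -> R :=
  'pinv_(fun=> 0%R) [set z : R | (0 < z)%R] (U' U).

End Utility.

(* Main.v *)
Require Import Defs.
From HB Require Import structures.
From mathcomp Require Import all_boot all_order all_algebra.
From mathcomp Require Import all_classical all_reals all_analysis.
From mathcomp Require Import measurable_realfun.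
From mathcomp Require Import ring lra.

Set Implicit Arguments.
Unset Strict Implicit.
Unset Printing Implicit Defensive.

Import Order.TTheory GRing.Theory Num.Theory.
Import numFieldNormedType.Exports.

Local Open Scope classical_set_scope.
Local Open Scope ring_scope.
Local Open Scope ereal_scope.

(** Everything happens pointwise in [x]. With the abbreviation
[g = lam * dPdQa x], maximality of [U z - g * z] at [z = eps x], where [U z]
is finite, is by moving terms across the inequality the same as [g] being a
supergradient of [U] at [eps x] ([superdifferential_argmax]). This is the
supergradient form, and it turns the other three claims into statements about
the supergradients of one function on the half line.

- A strictly increasing [U] has no supergradient 0, while [lam = 0] would make
  0 a supergradient at almost every point of a measure that is not zero.
  Hence [lam > 0], and complementary slackness gives the unit expectation.
- If the slope of [U] at 0 is infinite, no real number is a supergradient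
  at 0, so that [eps] cannot vanish.
- Under the conditions on the derivative, the mean value theorem bounds the
  chord slope of [U] on [[v, w]] below by [U' w]; letting [v] tend to 0, the
  slopes at 0 are at least [U' w], hence tend to infinity, and the previous
  item applies: [eps > 0]. At an interior point the only supergradient is the
  derivative, whence [U' (eps x) = g], which is inverted by injectivity of
  [U']. As a strictly decreasing function with limit 0 at infinity, [U'] is
  positive, so 0 is never a supergradient and again [lam > 0]. *)

Section Superdifferential.
Context {R : realType}.
Implicit Types (U : \bar R -> \bar R) (z : \bar R) (g : R).

Lemma nonneg_reals_EFin (w : R) : nonneg_reals w%:E <-> (0 <= w)%R.
Proof. by rewrite /nonneg_reals /= ltry andbT lee_fin. Qed.

Lemma nonneg_realsP z : nonneg_reals z -> exists2 a : R, (0 <= a)%R & z = a%:E.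
Proof. by case: z => [a /nonneg_reals_EFin a0|/andP[]|/andP[]]//; exists a. Qed.

(** Only values at finite arguments are compared and [U z] is finite, so the
rearrangement is legitimate even where [U] is infinite. *)
Lemma superdifferential_argmax U z g :
  superdifferential U z g <->
  U z \is a fin_num /\ argmax nonneg_reals (fun w => U w - g%:E * w) z.
Proof.
have tiltE (a b : R) (c u : \bar R) : u \is a fin_num ->
    (c - u <= g%:E * (b%:E - a%:E)) = (c - g%:E * b%:E <= u - g%:E * a%:E).
  case: u => [u||]// _; rewrite leeBlDr// leeBlDr//.
  by rewrite -EFinB -!EFinM -EFinB -!EFinD; congr (_ <= _%:E); ring.
split=> [[/nonneg_realsP[a a0 ->] Uz gz]|[Uz [/nonneg_realsP[a a0 zE] zmax]]].
- split=> //; split; first exact/nonneg_reals_EFin.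
  move=> w w0; move: (gz _ w0); case/nonneg_realsP: w0 => b _ ->.
  by rewrite tiltE.
- rewrite zE in Uz zmax *; split=> //; first exact/nonneg_reals_EFin.
  move=> w w0; move: (zmax _ w0); case/nonneg_realsP: w0 => b _ ->.
  by rewrite tiltE.
Qed.

(** A supergradient 0 at [z] makes [z] a maximizer of [U] on [[0, oo)], but
[U (z + 1)] is larger. *)
Lemma strictly_increasing_superdifferential_neq0 U z :
  strictly_increasing U -> ~ superdifferential U z 0%R.
Proof.
move=> Uinc [z0 Uz /(_ (z + 1))].
case/nonneg_realsP: z0 Uz => {}z z0 -> Uz.
have z10 : nonneg_reals (z%:E + 1) by apply/nonneg_reals_EFin; lra.
move=> /(_ z10); rewrite mul0e sube_le0 leNgt => /negP; apply.
apply: Uinc => //; first exact/nonneg_reals_EFin.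
by rewrite -EFinD lte_fin; lra.
Qed.

(** A supergradient at 0 is an upper bound of all slopes
[(U z - U 0) / z]. *)
Lemma superdifferential0_slope_unbounded U g :
  (U z%:E - U 0) * (z^-1)%:E @[z --> (0 : R)%R^'+] --> +oo ->
  ~ superdifferential U 0 g.
Proof.
move=> /cvgeyPge /(_ (g + 1)%R) slope [_ U0 gz].
near (0 : R)%R^'+ => z.
have z0 : (0 < z)%R by near: z; exact: nbhs_right_gt.
have : (g + 1)%:E <= (U z%:E - U 0) * (z^-1)%:E by near: z; exact: slope.
rewrite lee_pdivlMr// => gz1.
have zR : nonneg_reals z%:E by apply/nonneg_reals_EFin/ltW.
have := le_trans gz1 (gz _ zR).
by rewrite sube0 -!EFinM lee_fin; nra.
Unshelve. all: by end_near.
Qed.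

End Superdifferential.

Section Differentiable.
Context {R : realType} (U : \bar R -> \bar R).
Hypothesis Udiff : differentiable_on_pos U.

Lemma real_partE (z : R) : (0 < z)%R -> U z%:E = (real_part U z)%:E.
Proof. by move=> /Udiff[Uz _]; rewrite /real_part fineK. Qed.

Lemma is_derive_real_part (z : R) :
  (0 < z)%R -> is_derive z 1%R (real_part U) (U' U z).
Proof. by move=> /Udiff[_ /derivableP]; rewrite /U' derive1E. Qed.

(** Fermat's rule for the tilted function [U w - g * w], which is maximal
at the interior point [z]. *)
Lemma superdifferential_derive (z g : R) :
  (0 < z)%R -> superdifferential U z%:E g -> U' U z = g.
Proof.
move=> z0 [_ _ gz].
pose h := fun w : R => (real_part U w - g * w)%R.
have hD (w : R) : (0 < w)%R -> is_derive w 1%R h (U' U w - g)%R.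
  move=> w0; have := is_derive_real_part w0 => ?.
  apply: is_deriveB; rewrite -[X in is_derive _ _ _ X]mulr1.
  exact: is_deriveZ.
(* Fermat's rule needs a bounded interval around z; any bound above z does. *)
have z1 : (0 <= z + 1)%R by lra.
have zI : z \in `]0%R, (z + 1)%R[ by rewrite in_itv/= z0 ltrDl ltr01.
have hz : is_derive z 1%R h 0%R.
  apply: (derive1_at_max z1) => // w; rewrite in_itv/= => /andP[w0 _].
    by have [] := hD _ w0.
  have /gz : nonneg_reals w%:E by apply/nonneg_reals_EFin/ltW.
  by rewrite !real_partE// -EFinB -EFinB -EFinM lee_fin /h; lra.
apply/eqP; rewrite -subr_eq0; apply/eqP.
rewrite -(@derive_val _ _ _ _ _ _ _ hz).
by rewrite (@derive_val _ _ _ _ _ _ _ (hD _ z0)).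
Qed.

Hypothesis U'_decr :
  forall x y : R, (0 < x)%R -> (x < y)%R -> (U' U y < U' U x)%R.

Lemma U'_inj : {in [set z : R | (0 < z)%R] &, injective (U' U)}.
Proof.
move=> x y; rewrite !inE/= => x0 y0 xy.
by have [/(U'_decr x0)|/(U'_decr y0)|//] := ltgtP x y; rewrite xy ltxx.
Qed.

(** The limit 0 of the decreasing [U'] is a lower bound, and comparing with
[z + 1] makes the bound strict. *)
Lemma U'_gt0 (z : R) :
  U' U w @[w --> +oo%R] --> (0 : R)%R -> (0 < z)%R -> (0 < U' U z)%R.
Proof.
move=> U'oo z0; apply: (@le_lt_trans _ _ (U' U (z + 1)%R)); last first.
  by apply: U'_decr => //; lra.
apply: (cvgr_to_le U'oo); near=> w.
have zw : (z + 1 < w)%R by near: w; exact: (nbhs_pinfty_gt (num_real _)).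
by apply/ltW/U'_decr => //; lra.
Unshelve. all: by end_near.
Qed.

(** The chord slope is the derivative at some intermediate point, which is
to the left of [w]. *)
Lemma le_chord_right_derive (v w : R) : (0 < v)%R -> (v < w)%R ->
  (U' U w * (w - v) <= real_part U w - real_part U v)%R.
Proof.
move=> v0 vw.
have [c|c cI|c cI ->] := @MVT R (real_part U) (U' U) v w vw.
- rewrite in_itv/= => /andP[vc _].
  by apply: is_derive_real_part; exact: lt_trans vc.
- apply: derivable_within_continuous => x; rewrite in_itv/= => /andP[vx _].
  by have /Udiff[] : (0 < x)%R by exact: lt_le_trans vx.
- move: cI; rewrite in_itv/= => /andP[vc cw].
  by rewrite ler_pM2r ?subr_gt0//; apply/ltW/U'_decr => //; exact: lt_trans vc.
Qed.

Hypothesis U0_lim : U z%:E @[z --> (0 : R)%R^'+] --> U 0.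

(** Limit of the chord inequality as its left end tends to 0; right continuity
of [U] at 0 replaces the mean value theorem on [[0, w]]. *)
Lemma derive_le_slope0 (w : R) : U 0 \is a fin_num -> (0 < w)%R ->
  (U' U w)%:E <= (U w%:E - U 0) * (w^-1)%:E.
Proof.
move=> U0 w0; rewrite lee_pdivlMr// real_partE// -(fineK U0) -EFinB -EFinM.
rewrite lee_fin.
have u0 : real_part U v @[v --> (0 : R)%R^'+] --> fine (U 0).
  by apply: fine_cvg; rewrite fineK.
have lin0 : (U' U w * v)%R @[v --> (0 : R)%R^'+] --> (U' U w * 0)%R.
  by apply: cvgMr; apply: cvg_at_right_filter; exact: cvg_id.
suff : (fine (U 0) - U' U w * 0 <= real_part U w - U' U w * w)%R.
  by rewrite mulr0; lra.
apply: (cvgr_to_le (cvgB u0 lin0)); near=> v.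
have v0 : (0 < v)%R by near: v; exact: nbhs_right_gt.
have vw : (v < w)%R by near: v; exact: nbhs_right_lt.
by have := le_chord_right_derive v0 vw; rewrite mulrBr !fctE; lra.
Unshelve. all: by end_near.
Qed.

Lemma slope0_pinfty : U 0 \is a fin_num ->
  U' U z @[z --> (0 : R)%R^'+] --> +oo%R ->
  (U z%:E - U 0) * (z^-1)%:E @[z --> (0 : R)%R^'+] --> +oo.
Proof.
move=> U0 /cvgryPge U'0; apply/cvgeyPge => A; near=> z.
have z0 : (0 < z)%R by near: z; exact: nbhs_right_gt.
apply: le_trans (derive_le_slope0 U0 z0); rewrite lee_fin.
by near: z; exact: U'0.
Unshelve. all: by end_near.
Qed.

End Differentiable.

Theorem corollary5 (R : realType) (d : measure_display) (X : measurableType d)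
  (H : set (probability X R)) (Q : probability X R)
  (Qa Qs : {measure set X -> \bar R})
  (hQ : lebesgue_decomposition H Q Qa Qs)
  (U : \bar R -> \bar R)
  (mU : measurable_fun [set z : \bar R | 0 <= z] U)
  (lam : R) (lam_ge0 : (0 <= lam)%R)
  (P : {measure set X -> \bar R})
  (hP : effective_hypothesis H P) (PQa : P `<< Qa)
  (dPdQa : X -> R) (hdP : RN_derivative P Qa dPdQa)
  (eps : X -> \bar R) (heps : e_value H eps)
  (hslack : lam%:E * (1 - \int[P]_x eps x) = 0)
  (hfin : \forall x \ae Qa, U (eps x) \is a fin_num) :
  let star := \forall x \ae Qa,
    argmax nonneg_reals (fun z => U z - (lam * dPdQa x)%:E * z) (eps x) in
  [/\ (* positive multiplier *)
      star -> strictly_increasing U -> 0 < Qa [set: X] ->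
        (0 < lam)%R /\ \int[P]_x eps x = 1,
      (* supergradient form *)
      concave U ->
        (star <->
         \forall x \ae Qa, superdifferential U (eps x) (lam * dPdQa x)%R),
      (* positivity *)
      star -> U 0 \is a fin_num ->
        (U z%:E - U 0) * (z^-1)%:E @[z --> (0 : R)%R^'+] --> +oo ->
        \forall x \ae Qa, 0 < eps x
    & (* explicit form *)
      star ->
        U z%:E @[z --> (0 : R)%R^'+] --> U 0 ->
        differentiable_on_pos U ->
        (forall x y : R, (0 < x)%R -> (x < y)%R -> (U' U y < U' U x)%R) ->
        U' U z @[z --> (0 : R)%R^'+] --> +oo%R ->
        U' U z @[z --> +oo%R] --> (0 : R)%R ->
        0 < Qa [set: X] ->
        (0 < lam)%R /\
        \forall x \ae Qa,
          (U' U @` [set z : R | (0 < z)%R]) (lam * dPdQa x)%R /\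
          eps x = (U'_inv U (lam * dPdQa x)%R)%:E].
Proof.
move=> star.
have starP : star <->
    \forall x \ae Qa, superdifferential U (eps x) (lam * dPdQa x)%R.
  split; last by apply: filterS => x /superdifferential_argmax[].
  by apply: filterS2 hfin => x Ux zmax; apply/superdifferential_argmax.
(* Positivity of lam is needed under two different assumptions on U, which
   matter only through the absence of the supergradient 0. *)
have lam_gt0 : star -> 0 < Qa [set: X] ->
    (forall x, ~ superdifferential U (eps x) 0%R) -> (0 < lam)%R.
  move=> /starP + Qa0 no0; rewrite lt0r lam_ge0 andbT.
  case: eqP => // -> sd0; exfalso.
  have QaF := ae_properfilter_algebraOfSetsType Qa0.
  have [x] := @filter_ex _ _ QaF _ sd0.
  by rewrite mul0r; exact: no0.
split.
- move=> hstar Uinc Qa0.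
  have lam0 : (0 < lam)%R.
    apply: lam_gt0 => // x; exact: strictly_increasing_superdifferential_neq0.
  split=> //; move/eqP: hslack; rewrite mule_eq0 eqe gt_eqF//= => /eqP.
  case: (\int[P]_x eps x) => [r||]//.
  by rewrite -EFinB => -[] ?; congr EFin; lra.
- by move=> _.
- move=> /starP sd U0 slope; apply: filterS sd => x sd.
  have [/andP[eps0 _] _ _] := sd.
  rewrite lt_neqAle eps0 andbT; apply/eqP => eps0E.
  by move: sd; rewrite -eps0E; exact: superdifferential0_slope_unbounded.
- move=> hstar U0lim Udiff U'decr U'0 U'oo Qa0.
  (* The infinite slope excludes 0 for every g, also for g = 0: hence this can
     serve to prove lam > 0. *)
  have sd_interior (z : \bar R) (g : R) : superdifferential U z g ->
      exists2 y : R, (0 < y)%R & z = y%:E /\ U' U y = g.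
    move=> sd; have [+ Uz _] := sd.
    move=> /nonneg_realsP[y + zE]; rewrite zE in sd Uz *.
    rewrite le_eqVlt => /predU1P[y0|y0].
      rewrite -y0 in sd Uz; exfalso.
      by apply: superdifferential0_slope_unbounded sd; exact: slope0_pinfty.
    by exists y => //; split=> //; exact: superdifferential_derive.
  split.
    apply: lam_gt0 => // x /sd_interior[y y0 [_ U'y0]].
    by have := U'_gt0 U'decr U'oo y0; rewrite U'y0 ltxx.
  move/starP: hstar; apply: filterS => x /sd_interior[y y0 [-> <-]].
  split; first by exists y.
  by rewrite /U'_inv pinvKV ?inE//; exact: U'_inj.
Qed.
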